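(* Let $G\in\mathbb{R}^{n\times n}$ be symmetric positive definite, let $A\in\mathbb{R}^{n\times k}$ have full column rank $k$, and let $J\in\mathbb{R}^{n\times n}$ and an upper triangular $R\in\mathbb{R}^{k\times k}$ satisfy $$J^{\top}GJ=I_n,\qquad J^{\top}A=\begin{bmatrix}R\\0\end{bmatrix},$$ with $R$ nonsingular. Partition $J=[\,J_1\ \ J_2\,]$ with $J_1\in\mathbb{R}^{n\times k}$ and $J_2\in\mathbb{R}^{n\times(n-k)}$. Then: (i) $R^{\top}R=A^{\top}G^{-1}A$, so $R$ is a Cholesky factor of $A^{\top}G^{-1}A$, and it is unique up to the signs of its rows (any upper triangular $\hat R\in\mathbb{R}^{k\times k}$ with $\hat R^{\top}\hat R=A^{\top}G^{-1}A$ has the form $\hat R=SR$ with $S$ diagonal with entries $\pm1$); (ii) $\operatorname{range}(J_2)=\operatorname{null}(A^{\top})$, and the columns of $J_2$ are a $G$-orthonormal basis of $\operatorname{null}(A^{\top})$; (iii) $J_1=G^{-1}AR^{-1}$ and $\operatorname{range}(J_1)=\operatorname{range}(G^{-1}A)$, which is the $G$-orthogonal complement of $\operatorname{null}(A^{\top})$; (iv) $J_1J_1^{\top}=G^{-1}A(A^{\top}G^{-1}A)^{-1}A^{\top}G^{-1}$, and consequently $$J_2J_2^{\top}=G^{-1}-G^{-1}A\bigl(A^{\top}G^{-1}A\bigr)^{-1}A^{\top}G^{-1}.$$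
   Context: The $G$-inner product on $\mathbb{R}^n$ is $\langle v,w\rangle_G=v^{\top}Gw$; ''$G$-orthonormal'' and ''$G$-orthogonal complement'' refer to it. In the source, $A$ is the matrix of the normals of the $k$ constraints in the current working set of a quadratic program with Hessian $G$. *)

(* Defs.v *)
From HB Require Import structures.
From mathcomp Require Import all_boot all_order all_algebra.
From mathcomp Require Import reals.
Set Implicit Arguments.
Unset Strict Implicit.
Unset Printing Implicit Defensive.
Import Order.TTheory GRing.Theory Num.Theory.
Local Open Scope ring_scope.

Definition gdot (F : realType) (n : nat) (G : 'M[F]_n) (v w : 'cV[F]_n) : F :=
  (v^T *m G *m w) 0 0.

Definition spd_mx (F : realType) (n : nat) (G : 'M[F]_n) : Prop :=
  G^T = G /\ forall v : 'cV[F]_n, v != 0 -> 0 < gdot G v v.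

(* [is_trig_mx] is lower triangularity, hence the transpose. *)
Definition upper_trig_mx (F : realType) (k : nat) (R : 'M[F]_k) : bool :=
  is_trig_mx R^T.

(* No sign condition on the diagonal: a factor is only determined up to the
   signs of its rows. *)
Definition cholesky_factor (F : realType) (k : nat) (M R : 'M[F]_k) : Prop :=
  upper_trig_mx R /\ R^T *m R = M.

(* Range and null space of M acting on column vectors; the row-space operations
   of mxalgebra ([kermx], [<=%MS]) act on row vectors instead. *)
Definition mx_range (F : realType) (p q : nat) (M : 'M[F]_(p, q)) :
    {vspace 'cV[F]_p} :=
  limg (linfun (mulmx M : 'cV[F]_q -> 'cV[F]_p)).

Definition mx_null (F : realType) (p q : nat) (M : 'M[F]_(p, q)) :
    {vspace 'cV[F]_q} :=
  lker (linfun (mulmx M : 'cV[F]_q -> 'cV[F]_p)).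

Definition g_orthonormal_basis (F : realType) (n m : nat) (G : 'M[F]_n)
    (V : {vspace 'cV[F]_n}) (B : 'M[F]_(n, m)) : Prop :=
  basis_of V [seq col j B | j : 'I_m] /\
  forall i j : 'I_m, gdot G (col i B) (col j B) = (i == j)%:R.

Definition g_orthogonal_complement (F : realType) (n : nat) (G : 'M[F]_n)
    (V W : {vspace 'cV[F]_n}) : Prop :=
  forall w : 'cV[F]_n,
    w \in W <-> (forall v : 'cV[F]_n, v \in V -> gdot G v w = 0).

(* Main.v *)
(* Since J is square, J^T G J = 1 gives G^-1 = J J^T = J1 J1^T + J2 J2^T, while
   J^T A = [R; 0] splits into J1^T A = R and J2^T A = 0; hence G^-1 A = J1 R, from
   which every matrix identity follows. The range statements come from
   decomposing v = J J^T G v = J1 (J1^T G v) + J2 (J2^T G v). *)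

Require Import Defs.
From HB Require Import structures.
From mathcomp Require Import all_boot all_order all_algebra.
From mathcomp Require Import reals.
Set Implicit Arguments.
Unset Strict Implicit.
Unset Printing Implicit Defensive.
Import Order.TTheory GRing.Theory Num.Theory.
Local Open Scope ring_scope.

Lemma mem_mx_range (F : realType) (p q : nat) (M : 'M[F]_(p, q)) (w : 'cV[F]_p) :
  w \in mx_range M <-> exists u : 'cV[F]_q, w = M *m u.
Proof.
split=> [/memv_imgP[u _ ->]|[u ->]]; first by exists u; rewrite lfunE.
by apply/memv_imgP; exists u; rewrite ?memvf ?lfunE.
Qed.

Lemma mem_mx_null (F : realType) (p q : nat) (M : 'M[F]_(p, q)) (v : 'cV[F]_q) :
  (v \in mx_null M) = (M *m v == 0).
Proof. by rewrite memv_ker lfunE. Qed.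

Lemma mx_range_mulr_unit (F : realType) (p q : nat) (M : 'M[F]_(p, q))
    (U : 'M[F]_q) :
  U \in unitmx -> mx_range (M *m U) = mx_range M.
Proof.
move=> Uu; apply/vspaceP => w; apply/idP/idP => /mem_mx_range[u ->];
  apply/mem_mx_range.
  by exists (U *m u); rewrite mulmxA.
by exists (invmx U *m u); rewrite -mulmxA mulKVmx.
Qed.

(** The [q] columns span the range, and injectivity makes the range have dimension [q], so a
    spanning family of that size is a basis. *)
Lemma basis_of_mx_range (F : realType) (p q : nat) (M : 'M[F]_(p, q)) :
  (forall u : 'cV[F]_q, M *m u = 0 -> u = 0) ->
  basis_of (mx_range M) [seq col j M | j : 'I_q].
Proof.
move=> M_inj; rewrite basisEdim; apply/andP; split.
  apply/subvP => w /mem_mx_range[u ->].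
  have -> : M *m u = \sum_j u j 0 *: col j M.
    apply/colP => i; rewrite mxE summxE; apply: eq_bigr => j _.
    by rewrite !mxE mulrC.
  apply: rpred_sum => j _; apply/rpredZ/memv_span/map_f.
  by rewrite mem_enum.
rewrite size_map -cardE card_ord limg_dim_eq ?dimvf; first by rewrite /dim /= muln1.
apply/eqP; rewrite -subv0; apply/subvP => u.
by rewrite memv_cap mem_mx_null memv0 => /andP[_ /eqP/M_inj ->].
Qed.

Lemma gdot_col (F : realType) (n p q : nat) (G : 'M[F]_n) (B : 'M[F]_(n, p))
    (C : 'M[F]_(n, q)) (i : 'I_p) (j : 'I_q) :
  gdot G (col i B) (col j C) = (B^T *m G *m C) i j.
Proof. by rewrite /gdot tr_col -!row_mul colE mulmxA -colE !mxE. Qed.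

Lemma upper_trig_mxP (F : realType) (k : nat) (R : 'M[F]_k) :
  reflect (forall i j : 'I_k, (j < i)%N -> R i j = 0) (upper_trig_mx R).
Proof.
apply: (iffP is_trig_mxP) => h i j /h; rewrite ?mxE //.
Qed.

Lemma upper_trig_unit_diag (F : realType) (k : nat) (R : 'M[F]_k) (i : 'I_k) :
  upper_trig_mx R -> R \in unitmx -> R i i != 0.
Proof.
move=> R_up; rewrite unitmxE unitfE -det_tr det_trig // => /prodf_neq0/(_ i isT).
by rewrite mxE.
Qed.

(** Strong induction on the column [j]. Below the diagonal, [(S *m R) i j] reduces to
    [S i j * R j j]: terms with [l < j] vanish by induction, those with [l > j] because [R] is upper
    triangular. The pivot [R j j] is nonzero and cancels. *)
Lemma upper_trig_mull (F : realType) (k : nat) (S R : 'M[F]_k) :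
  upper_trig_mx R -> R \in unitmx -> upper_trig_mx (S *m R) ->
  upper_trig_mx S.
Proof.
move=> R_up R_u /upper_trig_mxP SR_up; apply/upper_trig_mxP => i j.
have [b] := ubnP (val j); elim: b j => // b IHb j ltjb ltji.
apply: (mulIf (upper_trig_unit_diag j R_up R_u)); rewrite mul0r.
rewrite -(SR_up i j ltji) mxE (bigD1 j) //= big1 ?addr0 // => l neq_lj.
have [ltlj|ltjl|/val_inj eq_lj] := ltngtP l j.
- by rewrite (IHb l (leq_trans ltlj ltjb) (ltn_trans ltlj ltji)) mul0r.
- by rewrite (upper_trig_mxP _ R_up) ?mulr0.
- by rewrite eq_lj eqxx in neq_lj.
Qed.

(* The factor [S = Rhat R^-1] is orthogonal; both [S] and its inverse [S^T] carry
   one triangular factor to the other, so [S] is diagonal. *)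
Lemma cholesky_factor_uniq (F : realType) (k : nat) (M R Rhat : 'M[F]_k) :
  R \in unitmx -> cholesky_factor M R -> cholesky_factor M Rhat ->
  exists s : 'rV[F]_k,
    (forall i : 'I_k, s 0 i = 1 \/ s 0 i = -1) /\ Rhat = diag_mx s *m R.
Proof.
move=> R_u [R_up RR] [Rh_up RhRh].
have Rh_u : Rhat \in unitmx.
  have : Rhat^T *m Rhat \in unitmx by rewrite RhRh -RR unitmx_mul unitmx_tr R_u.
  by rewrite unitmx_mul => /andP[].
pose S := Rhat *m invmx R.
have SR : S *m R = Rhat by rewrite mulmxKV.
have SS : S^T *m S = 1%:M.
  rewrite trmx_mul -mulmxA (mulmxA _ Rhat) RhRh -RR trmx_inv -mulmxA mulmxV //.
  by rewrite mulmx1 mulVmx // unitmx_tr.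
have S_up : upper_trig_mx S by apply: (upper_trig_mull R_up); rewrite ?SR.
have St_up : upper_trig_mx S^T.
  by apply: (upper_trig_mull Rh_up); rewrite // -SR mulmxA SS mul1mx.
have /diag_mxP[s S_diag] : is_diag_mx S.
  by rewrite is_diag_mxEtrig; move: St_up; rewrite /upper_trig_mx trmxK => ->.
exists s; split; last by rewrite -S_diag SR.
(* For diagonal [S], the diagonal entries of [S^T *m S = 1] read [s_i^2 = 1]. *)
move=> i; have := congr1 (fun X : 'M_k => X i i) SS.
rewrite S_diag tr_diag_mx mul_diag_mx !mxE eqxx mulr1n -expr2 => /eqP.
by rewrite sqrf_eq1 => /orP[]/eqP; [left|right].
Qed.

(* The dimension n is k + m, so that m = n - k. *)
Theorem proposition3p1 (F : realType) (k m : nat)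
    (G : 'M[F]_(k + m)) (A : 'M[F]_(k + m, k))
    (J : 'M[F]_(k + m)) (R : 'M[F]_k)
    (J1 : 'M[F]_(k + m, k)) (J2 : 'M[F]_(k + m, m))
    (G_spd : spd_mx G)
    (A_rank : \rank A = k)
    (R_upper : upper_trig_mx R)
    (J_orth : J^T *m G *m J = 1%:M)
    (J_fact : J^T *m A = col_mx R 0)
    (R_unit : R \in unitmx)
    (J_part : J = row_mx J1 J2) :
  [/\
    (* (i) *)
    [/\ R^T *m R = A^T *m invmx G *m A,
        cholesky_factor (A^T *m invmx G *m A) R
      & forall Rhat : 'M[F]_k,
          upper_trig_mx Rhat ->
          Rhat^T *m Rhat = A^T *m invmx G *m A ->
          exists s : 'rV[F]_k,
            (forall i : 'I_k, s 0 i = 1 \/ s 0 i = -1) /\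
            Rhat = diag_mx s *m R],
    (* (ii) *)
    mx_range J2 = mx_null A^T /\ g_orthonormal_basis G (mx_null A^T) J2,
    (* (iii) *)
    [/\ J1 = invmx G *m A *m invmx R,
        mx_range J1 = mx_range (invmx G *m A)
      & g_orthogonal_complement G (mx_null A^T) (mx_range (invmx G *m A))]
  & (* (iv) *)
    J1 *m J1^T =
      invmx G *m A *m invmx (A^T *m invmx G *m A) *m A^T *m invmx G /\
    J2 *m J2^T =
      invmx G - invmx G *m A *m invmx (A^T *m invmx G *m A) *m A^T *m invmx G].
Proof.
have JJG : J *m J^T *m G = 1%:M by rewrite -mulmxA (mulmx1C J_orth).
have G_u : G \in unitmx by case: (mulmx1_unit JJG).
have G_inv : invmx G = J *m J^T by rewrite -[LHS]mul1mx -JJG mulmxK.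
have GT : (invmx G)^T = invmx G by rewrite trmx_inv G_spd.1.
have G_split : invmx G = J1 *m J1^T + J2 *m J2^T.
  by rewrite G_inv J_part tr_row_mx mul_row_col.
move: J_fact; rewrite J_part tr_row_mx mul_col_mx => /eq_col_mx[J1A J2A].
have AJ1 : A^T *m J1 = R^T by rewrite -J1A trmx_mul trmxK.
have AJ2 : A^T *m J2 = 0 by rewrite -[J2]trmxK -trmx_mul J2A trmx0.
have GA : invmx G *m A = J1 *m R.
  by rewrite G_split mulmxDl -!mulmxA J1A J2A mulmx0 addr0.
have J1E : J1 = invmx G *m A *m invmx R by rewrite GA mulmxK.
have RR : R^T *m R = A^T *m invmx G *m A by rewrite -mulmxA GA mulmxA AJ1.
have J2GJ2 : J2^T *m G *m J2 = 1%:M.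
  (* This is the lower right block of [J^T G J = I]. *)
  move: J_orth; rewrite J_part tr_row_mx mul_col_mx mul_col_row scalar_mx_block.
  by case/eq_block_mx.
have decomp (v : 'cV[F]_(k + m)) :
    v = J1 *m (J1^T *m G *m v) + J2 *m (J2^T *m G *m v).
  by rewrite !mulmxA -!mulmxDl -G_split mulVmx // mul1mx.
(* Hence the [J1] component in [decomp] vanishes on the null space of [A^T], leaving only the [J2]
   component. *)
have J1G : J1^T *m G = (invmx R)^T *m A^T.
  by rewrite J1E !trmx_mul GT mulmxA mulmxKV.
have rangeJ2 : mx_range J2 = mx_null A^T.
  apply/vspaceP => v; rewrite mem_mx_null; apply/idP/eqP.
    by case/mem_mx_range=> u ->; rewrite mulmxA AJ2 mul0mx.
  move=> Av; apply/mem_mx_range; exists (J2^T *m G *m v).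
  by rewrite {1}(decomp v) J1G -(mulmxA _ A^T) Av !mulmx0 add0r.
have rangeJ1 : mx_range J1 = mx_range (invmx G *m A).
  by rewrite GA mx_range_mulr_unit.
have J1J1 : J1 *m J1^T =
    invmx G *m A *m invmx (A^T *m invmx G *m A) *m A^T *m invmx G.
  (* By (i) the matrix to invert is [R^T R]; the two inverse factors are then absorbed into
     [J1 = G^-1 A R^-1] and its transpose. *)
  have -> : invmx (A^T *m invmx G *m A) = invmx R *m (invmx R)^T.
    rewrite -RR -[LHS]mulmx1; apply: (canLR (mulKmx _)).
      by rewrite unitmx_mul unitmx_tr R_unit.
    by rewrite -mulmxA mulKVmx // trmx_inv mulmxV // unitmx_tr.
  by rewrite J1E !trmx_mul GT !mulmxA.
split=> //.
- split=> // Rhat Rh_up RhRh.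
  exact: (@cholesky_factor_uniq _ _ (A^T *m invmx G *m A)).
- split=> //; split; last by move=> i j; rewrite gdot_col J2GJ2 mxE.
  (* Injectivity of [J2] holds because [J2^T G] is a left inverse. *)
  rewrite -rangeJ2; apply: basis_of_mx_range => u J2u.
  by rewrite -[u]mul1mx -J2GJ2 -mulmxA J2u mulmx0.
- split=> // w; split=> [/mem_mx_range[u ->] v|w_orth].
    rewrite mem_mx_null => /eqP Av.
    rewrite /gdot !mulmxA mulmxK //.
    by rewrite -[v^T *m A]trmxK trmx_mul trmxK Av trmx0 mul0mx mxE.
  rewrite -rangeJ1; apply/mem_mx_range; exists (J1^T *m G *m w).
  (* The entries of [J2^T G w] are the [G]-inner products of [w] with the columns of [J2], which lie
     in the null space of [A^T]. So [w] has no [J2] component. *)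
  have J2Gw : J2^T *m G *m w = 0.
    apply/colP => j; rewrite [RHS]mxE -(w_orth (col j J2)).
      by rewrite -[w in RHS](col_id 0) gdot_col.
    by rewrite mem_mx_null colE mulmxA AJ2 mul0mx.
  by rewrite {1}(decomp w) J2Gw mulmx0 addr0.
- by split=> //; rewrite -J1J1 G_split addrAC subrr add0r.
Qed.
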